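(* Let $\mathcal{H}$ be a complex Hilbert space, let $T\in\mathcal{B}(\mathcal{H})$ be generalized Drazin invertible with closed range, and let $T^{-}$ be a fixed inner inverse of $T$. Then $X=T^dTT^{-}$ is the unique solution $X\in\mathcal{B}(\mathcal{H})$ of the system of operator equations $$XTX=X,\qquad T^dX=T^dT^{-},\qquad XT=T^dT.$$
   Context: $\mathcal{B}(\mathcal{H})$ is the space of bounded linear operators on $\mathcal{H}$. An operator $Q$ is quasinilpotent if $\|Q^n\|^{1/n}\to0$. $T\in\mathcal{B}(\mathcal{H})$ is generalized Drazin invertible if there is $X\in\mathcal{B}(\mathcal{H})$ with $XTX=X$, $TX=XT$ and $T-T^2X$ quasinilpotent; such an $X$ is unique and is denoted $T^d$. An inner inverse of $T$ is $T^{-}\in\mathcal{B}(\mathcal{H})$ with $TT^{-}T=T$ (one exists iff the range of $T$ is closed). *)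

(* Defs.v *)
From HB Require Import structures.
From mathcomp Require Import all_boot all_order all_algebra.
From mathcomp Require Import complex.
From mathcomp Require Import all_classical all_reals all_analysis.

Set Implicit Arguments.
Unset Strict Implicit.
Unset Printing Implicit Defensive.

Import Order.TTheory GRing.Theory Num.Theory.
Import numFieldNormedType.Exports.

Local Open Scope classical_set_scope.
Local Open Scope complex_scope.
Local Open Scope ring_scope.

(* Completeness and the norm come from [CompleteNormedModule]; [inner] is
   linear in its first argument and conjugate-linear in its second one. *)
HB.mixin Record hasInner (R : realType) (H : Type)
    & CompleteNormedModule R[i] H := {
  inner : {dot H for (@Num.conj R[i])} ;
  sqr_normE : forall x : H, `|x| ^+ 2 = inner x x
}.

#[short(type="hilbertType")]
HB.structure Definition Hilbert (R : realType) :=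
  { H of CompleteNormedModule R[i] H & hasInner R H }.

Section BoundedOperators.
Variables (R : realType) (H : hilbertType R).

Record bounded_op := BoundedOp {
  op_fun :> H -> H ;
  op_linear : linear op_fun ;
  op_bounded : exists M : R, forall x, `|op_fun x| <= M%:C * `|x|
}.

HB.instance Definition _ (T : bounded_op) :=
  GRing.isLinear.Build R[i] H H _ (op_fun T) (op_linear T).

HB.instance Definition _ := gen_eqMixin bounded_op.
HB.instance Definition _ := gen_choiceMixin bounded_op.

Lemma op_ext (S T : bounded_op) : S =1 T -> S = T.
Proof.
case: S T => [f Lf Bf] [g Lg Bg] /= /funext fg.
by case: _ / fg Lg Bg => Lg Bg; congr BoundedOp; exact: Prop_irrelevance.
Qed.

Lemma op_nneg_bound (T : bounded_op) :
  exists2 M : R, 0 <= M & forall x, `|T x| <= M%:C * `|x|.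
Proof.
have [M MT] := op_bounded T; exists `|M| => // x.
by rewrite (le_trans (MT x))// ler_wpM2r// lecR ler_norm.
Qed.

Fact op_zero_linear : linear (fun _ : H => 0 : H).
Proof. by move=> a x y; rewrite scaler0 addr0. Qed.
Fact op_zero_bounded :
  exists M : R, forall x : H, `|(fun _ : H => 0 : H) x| <= M%:C * `|x|.
Proof. by exists 0 => x; rewrite normr0 mul0r. Qed.
Definition op_zero := BoundedOp op_zero_linear op_zero_bounded.

Fact op_one_linear : linear (@id H). Proof. by []. Qed.
Fact op_one_bounded : exists M : R, forall x : H, `|id x| <= M%:C * `|x|.
Proof. by exists 1 => x; rewrite mul1r. Qed.
Definition op_one := BoundedOp op_one_linear op_one_bounded.

Fact op_opp_linear (T : bounded_op) : linear (fun x => - T x).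
Proof. by move=> a x y; rewrite linearP opprD scalerN. Qed.
Fact op_opp_bounded (T : bounded_op) :
  exists M : R, forall x, `|(fun x => - T x) x| <= M%:C * `|x|.
Proof. by have [M MT] := op_bounded T; exists M => x; rewrite normrN. Qed.
Definition op_opp T := BoundedOp (op_opp_linear T) (op_opp_bounded T).

Fact op_add_linear (S T : bounded_op) : linear (fun x => S x + T x).
Proof. by move=> a x y; rewrite !linearP scalerDr addrACA. Qed.
Fact op_add_bounded (S T : bounded_op) :
  exists M : R, forall x, `|(fun x => S x + T x) x| <= M%:C * `|x|.
Proof.
have [M MS] := op_bounded S; have [N NT] := op_bounded T.
exists (M + N) => x; rewrite rmorphD mulrDl.
by rewrite (le_trans (ler_normD _ _))// lerD.
Qed.
Definition op_add S T := BoundedOp (op_add_linear S T) (op_add_bounded S T).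

Fact op_comp_linear (S T : bounded_op) : linear (fun x => S (T x)).
Proof. by move=> a x y; rewrite !linearP. Qed.
Fact op_comp_bounded (S T : bounded_op) :
  exists M : R, forall x, `|(fun x => S (T x)) x| <= M%:C * `|x|.
Proof.
have [M M0 MS] := op_nneg_bound S; have [N NT] := op_bounded T.
exists (M * N) => x; rewrite rmorphM -mulrA.
by rewrite (le_trans (MS _))// ler_wpM2l// lecR.
Qed.
Definition op_comp S T :=
  BoundedOp (op_comp_linear S T) (op_comp_bounded S T).

Fact op_addA : associative op_add.
Proof. by move=> S T U; apply: op_ext => x /=; rewrite addrA. Qed.
Fact op_addC : commutative op_add.
Proof. by move=> S T; apply: op_ext => x /=; rewrite addrC. Qed.
Fact op_add0 : left_id op_zero op_add.
Proof. by move=> T; apply: op_ext => x /=; rewrite add0r. Qed.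
Fact op_addN : left_inverse op_zero op_opp op_add.
Proof. by move=> T; apply: op_ext => x /=; rewrite addNr. Qed.
HB.instance Definition _ :=
  GRing.isZmodule.Build bounded_op op_addA op_addC op_add0 op_addN.

(* Possibly trivial ring: no hypothesis excludes [H = 0]. *)
Fact op_compA : associative op_comp.
Proof. by move=> S T U; apply: op_ext. Qed.
Fact op_comp1l : left_id op_one op_comp.
Proof. by move=> T; apply: op_ext. Qed.
Fact op_comp1r : right_id op_one op_comp.
Proof. by move=> T; apply: op_ext. Qed.
Fact op_compDl : left_distributive op_comp op_add.
Proof. by move=> S T U; apply: op_ext. Qed.
Fact op_compDr : right_distributive op_comp op_add.
Proof. by move=> S T U; apply: op_ext => x /=; rewrite linearD. Qed.
HB.instance Definition _ := GRing.Zmodule_isPzRing.Build bounded_op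
  op_compA op_comp1l op_comp1r op_compDl op_compDr.

(* Norms in [H] take their (real) values in [R[i]], hence the real part. *)
Definition op_norm (T : bounded_op) : R :=
  sup [set complex.Re `|T x| | x in [set x : H | `|x| <= 1]].

(* The value at [n = 0] is irrelevant to the limit. *)
Definition quasinilpotent (Q : bounded_op) :=
  (fun n : nat => op_norm (Q ^+ n) `^ (n%:R^-1)) @ \oo --> (0 : R).

Definition gdrazin_inverse (T X : bounded_op) :=
  [/\ X * T * X = X, T * X = X * T & quasinilpotent (T - T ^+ 2 * X)].

Definition inner_inverse (T X : bounded_op) := T * X * T = T.

End BoundedOperators.

(* Main.v *)
Require Import Defs.
From mathcomp Require Import all_boot all_order all_algebra.
From mathcomp Require Import complex.
From mathcomp Require Import all_classical all_reals all_analysis.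

Local Open Scope classical_set_scope.
Local Open Scope ring_scope.

Import GRing.Theory.

Theorem theorem5 (R : realType) (H : hilbertType R)
    (T Td Tm : bounded_op H)
    (T_gdrazin : gdrazin_inverse T Td)
    (T_closed_range : closed (range T))
    (T_inner : inner_inverse T Tm) :
  unique (fun X : bounded_op H =>
      [/\ X * T * X = X, Td * X = Td * Tm & X * T = Td * T])
    (Td * T * Tm).
Proof.
have [TdTTd TTd _] := T_gdrazin.
split=> [|X [XTX TdX XT]].
  split.
  (* The inner factor [T * Tm * T] of [Td T Tm T Td T Tm] collapses to [T]; then
     [Td * T * Td = Td]. *)
  - by rewrite -!mulrA (mulrA Tm) (mulrA T) (mulrA T Tm) T_inner !mulrA TdTTd.
  (* Commuting [Td] with [T] exposes [Td * T * Td]. *)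
  - by rewrite -TTd !mulrA TdTTd.
  - by rewrite -!mulrA (mulrA T) T_inner.
(* The three equations and commutation determine [X]: [X = (X T) X = Td T X = T (Td X) = T Td Tm =
   Td T Tm]. *)
by rewrite -[RHS]XTX XT -TTd -[RHS]mulrA TdX mulrA.
Qed.
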